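(* Let $j\in\{\tfrac12,1,\tfrac32,\dots\}$, $p\in(0,1)$ and $\mathbb{N}_{2j}=\{0,1,\dots,2j\}$. The symmetric exclusion process on two sites is self-dual with duality function $D(x,n)=k(x_1,n_1)\,k(x_2,n_2)$, where $$k(x,n)=\left(\frac{p}{1-p}\right)^{\frac12(n+x)}K_n(x),\qquad x,n\in\mathbb{N}_{2j},$$ and $K_n(x)={}_2F_1\!\left(-n,-x;-2j;\tfrac1p\right)$ are the Krawtchouk polynomials. That is, with $L$ the generator of the process on two sites, $$[L D(\cdot,n)](x)=[L D(x,\cdot)](n)\qquad\text{for all } x=(x_1,x_2),\ n=(n_1,n_2)\in\mathbb{N}_{2j}^2 .$$
   Context: The symmetric exclusion process SEP($j$) on two sites is the Markov jump process on $\mathbb{N}_{2j}^2$ with generator $$(Lf)(x_1,x_2)=x_1(2j-x_2)\left[f(x_1-1,x_2+1)-f(x_1,x_2)\right]+(2j-x_1)x_2\left[f(x_1+1,x_2-1)-f(x_1,x_2)\right],$$ where a term with vanishing rate is understood to be zero. A process with generator $L$ and state space $\mathcal{S}$ is called self-dual with self-duality function $D:\mathcal{S}\times\mathcal{S}\to\mathbb{R}$ if $[LD(\cdot,y)](x)=[LD(x,\cdot)](y)$ for all $x,y\in\mathcal{S}$; on the left $L$ acts on $D$ as a function of the first argument, on the right as a function of the second argument. The hypergeometric function is here the finite sum $$ {}_2F_1\!\left(-n,-x;-2j;\tfrac1p\right)=\sum_{i=0}^{\min(n,x)}\frac{(-n)_i(-x)_i}{(-2j)_i}\frac{p^{-i}}{i!},\qquad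 (a)_i=a(a+1)\cdots(a+i-1),\ (a)_0=1 .$$ *)

(* Defs.v *)
From HB Require Import structures.
From mathcomp Require Import all_boot all_order all_algebra.
From mathcomp Require Import all_classical all_reals all_analysis.

Set Implicit Arguments.
Unset Strict Implicit.
Unset Printing Implicit Defensive.

Import Order.TTheory GRing.Theory Num.Theory.

Local Open Scope ring_scope.

(* The spin j in {1/2, 1, 3/2, ...} enters only through the positive integer
   twoj = 2j. *)
Definition sep_state (twoj : nat) : Type := ('I_twoj.+1 * 'I_twoj.+1)%type.

(* When a jump would leave the state space, [inord] returns a dummy site value,
   but the rate in front of the bracket is then 0. *)
Definition sep_generator (R : realType) (twoj : nat)
    (f : sep_state twoj -> R) (x : sep_state twoj) : R :=
  x.1%:R * (twoj%:R - x.2%:R) * (f (inord x.1.-1, inord x.2.+1) - f x)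
  + (twoj%:R - x.1%:R) * x.2%:R * (f (inord x.1.+1, inord x.2.-1) - f x).

Definition self_dual (R : realType) (S : Type)
    (L : (S -> R) -> S -> R) (D : S -> S -> R) : Prop :=
  forall x y : S, L (fun z => D z y) x = L (fun z => D x z) y.

Definition pochhammer (R : realType) (a : R) (i : nat) : R :=
  \prod_(k < i) (a + k%:R).

(* The terminating series 2F1(-n, -x; c; z). *)
Definition hyp2F1 (R : realType) (n x : nat) (c z : R) : R :=
  \sum_(i < (minn n x).+1)
    pochhammer (- n%:R) i * pochhammer (- x%:R) i / pochhammer c i
    * (z ^+ i / i`!%:R).

Definition krawtchouk (R : realType) (twoj : nat) (p : R) (n x : nat) : R :=
  hyp2F1 n x (- twoj%:R) (1 / p).

Definition sep_site_duality (R : realType) (twoj : nat) (p : R)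
    (x n : nat) : R :=
  (p / (1 - p)) `^ (1 / 2 * (n%:R + x%:R)) * krawtchouk twoj p n x.

Definition sep_duality (R : realType) (twoj : nat) (p : R)
    (x n : sep_state twoj) : R :=
  sep_site_duality twoj p x.1 n.1 * sep_site_duality twoj p x.2 n.2.

(* Main.v *)
Require Import Defs.
From mathcomp Require Import all_boot all_order all_algebra.
From mathcomp Require Import all_classical all_reals all_analysis.
From mathcomp Require Import ring.

Import Order.TTheory GRing.Theory Num.Theory.
Local Open Scope ring_scope.

(** The generator is the coproduct form L = A⊗B + B⊗A + 2 H⊗H - N^2/2 with
    N = 2j, (A f)(x) = x f(x-1), (B f)(x) = (N-x) f(x+1), (H f)(x) = (x - N/2) f(x).
    On the one-site function k(x,n), the operators acting in x agree with a
    linear transform of those acting in n: with q = sqrt(p(1-p)), u = 1-2p,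
      H   <-> - q (A+B) + u H,   A+B <-> - u (A+B) - 4 q H,   A-B <-> A-B.
    Since u^2 + 4 q^2 = 1, this transform preserves the quadratic form
    (A+B)⊗(A+B)/2 - (A-B)⊗(A-B)/2 + 2 H⊗H, which is L + N^2/2. The first two
    relations are the three-term recurrence in n and (by symmetry) in x; the
    third is a comparison of forward and backward shifts in both variables. *)

(** * Rising factorials and their unit shifts *)

Section Pochhammer.
Variable R : realType.
Implicit Types (a x : R) (i : nat).

Lemma pochhammerS a i : pochhammer a i.+1 = pochhammer a i * (a + i%:R).
Proof. by rewrite /pochhammer big_ord_recr. Qed.

Lemma pochhammerSl a i : pochhammer a i.+1 = a * pochhammer (a + 1) i.
Proof.
rewrite /pochhammer big_ord_recl addr0; congr (_ * _); apply: eq_bigr => k _.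
by rewrite /= /bump /= add1n -addrA -natr1 [1 + _]addrC.
Qed.

Lemma pochhammer_natN_eq0 (m i : nat) :
  (m < i)%N -> pochhammer (- m%:R : R) i = 0.
Proof.
move=> mi; rewrite /pochhammer (bigD1 (Ordinal mi)) //=.
by rewrite addNr mul0r.
Qed.

Lemma pochhammer_natN_neq0 (m i : nat) :
  (i <= m)%N -> pochhammer (- m%:R : R) i != 0.
Proof.
move=> im; rewrite /pochhammer; apply/prodf_neq0 => k _.
rewrite addrC subr_eq0 eqr_nat ltn_eqF //.
exact: leq_trans (ltn_ord k) im.
Qed.

(** Peeling off the first or the last factor of [pochhammer (- x) i.+1] gives the two sides, up to a
    common sign. *)
Lemma pochhammer_backward x i :
  x * pochhammer (- (x - 1)) i = (x - i%:R) * pochhammer (- x) i.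
Proof.
have := pochhammerSl (- x) i; rewrite pochhammerS.
have -> : - x + 1 = - (x - 1) by ring.
move=> h; apply: oppr_inj; rewrite -mulNr -h; ring.
Qed.

Lemma pochhammer_forward x i :
  pochhammer (- (x + 1)) i.+1
  = pochhammer (- x) i.+1 - i.+1%:R * pochhammer (- x) i.
Proof.
rewrite pochhammerSl; have -> : - (x + 1) + 1 = - x by ring.
rewrite pochhammerS -natr1; ring.
Qed.

End Pochhammer.

(** * Shift relations and the recurrence for Krawtchouk polynomials *)

Section KrawtchoukPolynomial.
Variables (R : realType) (N : nat) (p : R).
Hypothesis p_neq0 : p != 0.

Definition kcoef (i : nat) : R :=
  (pochhammer (- N%:R) i)^-1 * ((1 / p) ^+ i / i`!%:R).

Definition kterm (x n : R) (i : nat) : R :=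
  pochhammer (- n) i * pochhammer (- x) i * kcoef i.

(* The range of summation does not depend on [x] and [n], which may then be
   arbitrary real numbers. *)
Definition kpoly (x n : R) : R := \sum_(i < N.+1) kterm x n i.

(** Terms beyond [minn n x] contain a vanishing Pochhammer symbol. Bounding only the minimum lets
    one argument reach [N + 1] after a shift. *)
Lemma krawtchoukE (x n : nat) :
  (minn n x <= N)%N -> krawtchouk N p n x = kpoly x%:R n%:R.
Proof.
move=> le_N; rewrite /krawtchouk /hyp2F1 /kpoly.
rewrite (big_ord_widen N.+1
  (fun i => pochhammer (- n%:R) i * pochhammer (- x%:R) i /
    pochhammer (- N%:R) i * ((1 / p) ^+ i / i`!%:R))) //.
rewrite big_mkcond; apply: eq_bigr => i _; rewrite /kterm /kcoef.
case: ifPn => [_|]; first by rewrite !mulrA.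
rewrite ltnS -ltnNge gtn_min => /orP[] h.
  by rewrite [pochhammer (- n%:R) _]pochhammer_natN_eq0 // !mul0r.
by rewrite [pochhammer (- x%:R) _]pochhammer_natN_eq0 // mulr0 mul0r.
Qed.

Lemma ktermC (x n : R) (i : nat) : kterm x n i = kterm n x i.
Proof. by rewrite /kterm [X in X * _]mulrC. Qed.

Lemma kpolyC (x n : R) : kpoly x n = kpoly n x.
Proof. by apply: eq_bigr => i _; rewrite ktermC. Qed.

Lemma kcoefS (i : nat) : (i < N)%N ->
  i.+1%:R * kcoef i.+1 = - (p^-1 * (kcoef i / (N%:R - i%:R))).
Proof.
move=> iN; rewrite /kcoef pochhammerS exprS factS natrM.
have h1 := pochhammer_natN_neq0 R _ _ (ltnW iN).
have h2 : N%:R - i%:R != 0 :> R by rewrite subr_eq0 eqr_nat gtn_eqF.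
have h3 : i`!%:R != 0 :> R by rewrite pnatr_eq0 -lt0n fact_gt0.
have h4 : i.+1%:R != 0 :> R by rewrite pnatr_eq0.
have h5 : - N%:R + i%:R != 0 :> R by rewrite addrC -opprB oppr_eq0.
set P := pochhammer _ _ in h1 *; set Q := (1 / p) ^+ i.
rewrite -[i.+1]addn1 natrD in h4 *.
by field; rewrite ?h1 ?h2 ?h3 ?h4 ?h5 ?p_neq0.
Qed.

Lemma kpoly_backward (x n : R) :
  x * kpoly (x - 1) n = \sum_(i < N.+1) (x - i%:R) * kterm x n i.
Proof.
rewrite /kpoly mulr_sumr; apply: eq_bigr => i _; rewrite /kterm.
have h := pochhammer_backward R x i.
by rewrite !mulrA [x * _]mulrC -[_ * x * _]mulrA h; ring.
Qed.

(** Only terms of index [i.+1] change; [kcoefS] brings their increment back to index [i], which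
    creates the denominators [N - i]. *)
Lemma kpoly_forward (x n : R) : kpoly (x + 1) n =
  kpoly x n - p^-1 * \sum_(i < N) kterm x n i / (N%:R - i%:R) * (n - i%:R).
Proof.
rewrite /kpoly big_ord_recl [in RHS]big_ord_recl mulr_sumr -addrA -sumrB.
congr (_ + _); first by rewrite /kterm /pochhammer !big_ord0.
apply: eq_bigr => i _; rewrite /kterm !lift0 pochhammer_forward.
have h := kcoefS i (ltn_ord i).
transitivity (pochhammer (- n) i.+1 * pochhammer (- x) i.+1 * kcoef i.+1
   - pochhammer (- n) i.+1 * pochhammer (- x) i * (i.+1%:R * kcoef i.+1)).
  by ring.
by rewrite h (pochhammerS _ (- n)); ring.
Qed.

Lemma kpoly_backward_r (x n : R) :
  n * kpoly x (n - 1) = \sum_(i < N.+1) (n - i%:R) * kterm x n i.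
Proof.
by rewrite kpolyC kpoly_backward; apply: eq_bigr => i _; rewrite ktermC.
Qed.

Lemma kpoly_forward_r (x n : R) : kpoly x (n + 1) =
  kpoly x n - p^-1 * \sum_(i < N) kterm x n i / (N%:R - i%:R) * (x - i%:R).
Proof.
rewrite kpolyC kpoly_forward [kpoly n x]kpolyC; congr (_ - _ * _).
by apply: eq_bigr => i _; rewrite ktermC.
Qed.

(** Both sides equal [(1 - p) (x - n) K]. In the forward part, [(N - x) (n - i) - (N - n) (x - i) =
    (n - x) (N - i)] cancels the denominators. *)
Lemma kpoly_shift_comparison (x n : nat) : (x <= N)%N -> (n <= N)%N ->
  (1 - p) * (x%:R * kpoly (x%:R - 1) n%:R - n%:R * kpoly x%:R (n%:R - 1))
  = p * ((N%:R - x%:R) * kpoly (x%:R + 1) n%:R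
         - (N%:R - n%:R) * kpoly x%:R (n%:R + 1)).
Proof.
move=> xN nN.
pose t i := kterm x%:R n%:R i.
(* The forward sums stop before [i = N]; the missing term is harmless, as [t N] vanishes unless
   [x = n = N]. *)
have top : (x%:R - n%:R) * t N = 0.
  rewrite /t /kterm; move: xN nN; rewrite (leq_eqVlt x) (leq_eqVlt n).
  case/predU1P=> [->|xN]; last first.
    by rewrite (pochhammer_natN_eq0 R _ _ xN) !(mulr0, mul0r).
  case/predU1P=> [->|nN]; first by rewrite subrr mul0r.
  by rewrite (pochhammer_natN_eq0 R _ _ nN) !(mulr0, mul0r).
rewrite kpoly_backward kpoly_backward_r kpoly_forward kpoly_forward_r.
set K := kpoly _ _; set bx := \sum_(_ < _) _; set bn := \sum_(_ < _) _.
set fx := \sum_(_ < _) _; set fn := \sum_(_ < _) _.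
have back : bx - bn = (x%:R - n%:R) * K.
  by rewrite -sumrB mulr_sumr; apply: eq_bigr => i _; ring.
have fwd : (N%:R - x%:R) * fx - (N%:R - n%:R) * fn = - ((x%:R - n%:R) * K).
  rewrite /K /kpoly big_ord_recr /= -/(t N) mulrDr top addr0 !mulr_sumr -sumrB.
  rewrite -sumrN; apply: eq_bigr => i _.
  have h : N%:R - i%:R != 0 :> R by rewrite subr_eq0 eqr_nat gtn_eqF.
  by field.
rewrite back; transitivity (p * ((n%:R - x%:R) * K)
   - p * p^-1 * ((N%:R - x%:R) * fx - (N%:R - n%:R) * fn)); last by ring.
by rewrite fwd divff //; ring.
Qed.

(** Everything reduces to [I], the sum of the [i * t i]: it is the backward difference in [n], and
    an index shift turns [p * I] into [- g]. *)
Lemma kpoly_three_term (x n : nat) : (x <= N)%N ->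
  x%:R * kpoly x%:R n%:R
  = - p * ((N%:R - n%:R) * (kpoly x%:R (n%:R + 1) - kpoly x%:R n%:R))
    + (1 - p) * (n%:R * (kpoly x%:R n%:R - kpoly x%:R (n%:R - 1))).
Proof.
move=> xN.
pose t i := kterm x%:R n%:R i.
have top : (x%:R - N%:R) * t N = 0.
  rewrite /t /kterm; move: xN; rewrite leq_eqVlt.
  case/predU1P=> [->|xN]; first by rewrite subrr mul0r.
  by rewrite (pochhammer_natN_eq0 R _ _ xN) !(mulr0, mul0r).
rewrite [n%:R * (_ - _)]mulrBr kpoly_backward_r kpoly_forward_r.
set K := kpoly _ _; set f := \sum_(_ < _) _; set b := \sum_(_ < _) _.
pose I := \sum_(i < N.+1) i%:R * t i.
pose g := \sum_(i < N) t i / (N%:R - i%:R) * (x%:R - i%:R) * (n%:R - i%:R).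
have bE : n%:R * K - b = I.
  rewrite /K /b /kpoly mulr_sumr -sumrB; apply: eq_bigr => i _.
  by rewrite -/(t i); ring.
have IE : p * I = - g.
  rewrite /I big_ord_recl mul0r add0r mulr_sumr -sumrN.
  apply: eq_bigr => i _; rewrite lift0 /t /kterm !pochhammerS.
  have h := kcoefS i (ltn_ord i).
  transitivity (p * (pochhammer (- n%:R) i * (- n%:R + i%:R) *
    (pochhammer (- x%:R) i * (- x%:R + i%:R))) * (i.+1%:R * kcoef i.+1)).
    by ring.
  have h1 : N%:R - i%:R != 0 :> R by rewrite subr_eq0 eqr_nat gtn_eqF.
  by rewrite h; field; rewrite ?h1 ?p_neq0.
(* Termwise, this is the splitting [N - i = (N - n) + (n - i)]. *)
have xE : x%:R * K - I = (N%:R - n%:R) * f + g.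
  rewrite /K /I /kpoly mulr_sumr -sumrB big_ord_recr /=.
  rewrite -mulrBl -/(t N) top addr0.
  rewrite /f /g mulr_sumr -big_split /=; apply: eq_bigr => i _.
  have h1 : N%:R - i%:R != 0 :> R by rewrite subr_eq0 eqr_nat gtn_eqF.
  by rewrite -/(t i); field.
rewrite bE; transitivity (p * p^-1 * ((N%:R - n%:R) * f) + I - p * I).
  by rewrite IE divff // mul1r -[LHS](subrK I) xE; ring.
by ring.
Qed.

End KrawtchoukPolynomial.

(** * Intertwining relations for the one-site duality function *)

Section SiteDuality.
Variables (R : realType) (N : nat) (p : R).
Hypotheses (p_gt0 : 0 < p) (p_lt1 : p < 1).

Let s : R := (p / (1 - p)) `^ (1 / 2).
Let q : R := s * (1 - p).
Let u : R := 1 - 2 * p.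
Let k (x n : nat) : R := sep_site_duality N p x n.

Let p_neq0 : p != 0. Proof. by rewrite gt_eqF. Qed.
Let onem_neq0 : 1 - p != 0. Proof. by rewrite gt_eqF ?subr_gt0. Qed.

Let s_sqr : s ^+ 2 * (1 - p) = p.
Proof.
have c_ge0 : 0 <= p / (1 - p) by rewrite divr_ge0 ?subr_ge0 // ltW.
rewrite -powR_mulrn ?powR_ge0 // -powRrM.
by rewrite [X in _ `^ X](_ : _ = 1) ?powRr1 ?divfK //; field.
Qed.

Let s_neq0 : s != 0.
Proof. by rewrite gt_eqF // powR_gt0 // divr_gt0 ?subr_gt0. Qed.

Lemma site_q_sqr : q ^+ 2 = p * (1 - p).
Proof. by rewrite /q exprMn expr2 mulrA s_sqr. Qed.

Let kE (x n : nat) : (minn n x <= N)%N ->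
  k x n = s ^+ (n + x) * kpoly R N p x%:R n%:R.
Proof.
move=> nx; rewrite /k /sep_site_duality krawtchoukE //; congr (_ * _).
by rewrite powRrM -natrD powR_mulrn ?powR_ge0.
Qed.

Lemma sep_site_dualityC (x n : nat) : (x <= N)%N -> (n <= N)%N -> k x n = k n x.
Proof.
by move=> xN nN; rewrite !kE ?geq_min ?xN ?nN // addnC kpolyC.
Qed.

(** The operators A and B applied to [k], in [x] and then in [n]. Where a shift leaves [0..N], the
    coefficient is 0. *)
Definition lowerx (x n : nat) : R := x%:R * k x.-1 n.
Definition raisex (x n : nat) : R := (N%:R - x%:R) * k x.+1 n.
Definition lowern (x n : nat) : R := n%:R * k x n.-1.
Definition raisen (x n : nat) : R := (N%:R - n%:R) * k x n.+1.

(** The factor [s] avoids the exponent [n + x - 1], which natural subtraction would truncate. *)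
Let lowerxE (x n : nat) : (n <= N)%N -> s * lowerx x n =
  s ^+ (n + x) * (x%:R * kpoly R N p (x%:R - 1) n%:R).
Proof.
move=> nN; rewrite /lowerx kE ?geq_min ?nN //.
case: x => [|x]; first by rewrite !(mul0r, mulr0).
by rewrite -pred_Sn addnS exprS -[x.+1]addn1 natrD addrK; ring.
Qed.

Let raisexE (x n : nat) : (n <= N)%N -> raisex x n =
  s ^+ (n + x) * (s * ((N%:R - x%:R) * kpoly R N p (x%:R + 1) n%:R)).
Proof.
move=> nN; rewrite /raisex kE ?geq_min ?nN //.
by rewrite addnS exprS -[x.+1]addn1 natrD; ring.
Qed.

Let lowernE (x n : nat) : (x <= N)%N -> s * lowern x n =
  s ^+ (n + x) * (n%:R * kpoly R N p x%:R (n%:R - 1)).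
Proof.
move=> xN; rewrite /lowern kE ?geq_min ?xN ?orbT //.
case: n => [|n]; first by rewrite !(mul0r, mulr0).
by rewrite -pred_Sn addSn exprS -[n.+1]addn1 natrD addrK; ring.
Qed.

Let raisenE (x n : nat) : (x <= N)%N -> raisen x n =
  s ^+ (n + x) * (s * ((N%:R - n%:R) * kpoly R N p x%:R (n%:R + 1))).
Proof.
move=> xN; rewrite /raisen kE ?geq_min ?xN ?orbT //.
by rewrite addSn exprS -[n.+1]addn1 natrD; ring.
Qed.

(** The power of [s] symmetrizes the three-term recurrence: since [s ^+ 2 * (1 - p) = p], its
    coefficients [1 - p] and [p] both become [q]. *)
Lemma site_weight (x n : nat) : (x <= N)%N -> (n <= N)%N ->
  (x%:R - N%:R / 2) * k x n
  = - q * (lowern x n + raisen x n) + u * ((n%:R - N%:R / 2) * k x n).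
Proof.
move=> xN nN; rewrite kE ?geq_min ?nN //.
have h := kpoly_three_term R N p p_neq0 x n xN.
have -> : - q * (lowern x n + raisen x n) =
  - ((1 - p) * (s * lowern x n)) - q * raisen x n by rewrite /q; ring.
rewrite lowernE // raisenE // /q /u.
set w := s ^+ _; set K := kpoly _ _ _ x%:R n%:R in h *.
set Kp := kpoly _ _ _ _ _ in h *; set Km := kpoly _ _ _ _ _ in h *.
transitivity (w * (x%:R * K) - w * (N%:R / 2 * K)); first by ring.
rewrite h.
transitivity (- (w * (1 - p) * (n%:R * Km))
  - w * (s ^+ 2 * (1 - p)) * ((N%:R - n%:R) * Kp)
  + (1 - 2 * p) * ((n%:R - N%:R / 2) * (w * K))); last by ring.
by rewrite s_sqr; field.
Qed.

Lemma site_shift_diff (x n : nat) : (x <= N)%N -> (n <= N)%N ->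
  lowerx x n - raisex x n = lowern x n - raisen x n.
Proof.
move=> xN nN; have h := kpoly_shift_comparison R N p p_neq0 x n xN nN.
apply: (mulfI s_neq0); apply: (mulfI onem_neq0).
rewrite !mulrBr lowerxE // lowernE // raisexE // raisenE //.
move: h; set w := s ^+ _.
set a := _ * kpoly _ _ _ _ _; set b := _ * kpoly _ _ _ _ _.
set c := _ * kpoly _ _ _ _ _; set d := _ * kpoly _ _ _ _ _ => h.
apply/eqP; rewrite -subr_eq0; apply/eqP.
transitivity (w * ((1 - p) * (a - b)) - w * (s ^+ 2 * (1 - p)) * (c - d)).
  by ring.
by rewrite h s_sqr; ring.
Qed.

(** As [k] is symmetric, [site_weight] also holds with [x] and [n] exchanged. Inserting one version
    into the other and using [u ^+ 2 - 1 = - 4 * q ^+ 2], one divides by [q]. *)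
Lemma site_shift_sum (x n : nat) : (x <= N)%N -> (n <= N)%N ->
  lowerx x n + raisex x n
  = - u * (lowern x n + raisen x n) - 4 * q * ((n%:R - N%:R / 2) * k x n).
Proof.
move=> xN nN; have h := site_weight x n xN nN.
have xE : lowern n x + raisen n x = lowerx x n + raisex x n.
  rewrite /lowern /raisen /lowerx /raisex; congr (_ + _).
    by rewrite sep_site_dualityC // (leq_trans (leq_pred x)).
  move: xN; rewrite leq_eqVlt => /predU1P[->|xN]; first by rewrite subrr !mul0r.
  by rewrite sep_site_dualityC.
have := site_weight n x nN xN; rewrite xE [k n x]sep_site_dualityC //.
have q_neq0 : q != 0 by rewrite mulf_neq0.
set S := lowerx _ _ + _; set T := lowern _ _ + _ in h *.
rewrite h => h'.
apply: (mulfI q_neq0); apply: (addrI (- (q * S) + (n%:R - N%:R / 2) * k x n)).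
rewrite [in LHS]h'.
transitivity ((n%:R - N%:R / 2) * k x n - u * q * T
  - 4 * q ^+ 2 * ((n%:R - N%:R / 2) * k x n) - q * S); last by ring.
by rewrite site_q_sqr /u; ring.
Qed.

End SiteDuality.

(** * From one site to the two-site generator *)

Lemma sep_generatorE (R : realType) (N : nat) (f : nat -> nat -> R)
    (x : sep_state N) :
  sep_generator (fun z : sep_state N => f z.1 z.2) x
  = x.1%:R * (N%:R - x.2%:R) * (f x.1.-1 x.2.+1 - f x.1 x.2)
    + (N%:R - x.1%:R) * x.2%:R * (f x.1.+1 x.2.-1 - f x.1 x.2).
Proof.
have pred_val (i : 'I_N.+1) : (inord i.-1 : 'I_N.+1) = i.-1 :> nat.
  by rewrite inordK // (leq_ltn_trans (leq_pred i)).
(* A successor leaves the range only at [i = N], so the rate factor must accompany it. *)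
have succ_val (i : 'I_N.+1) (g : nat -> R) :
    (N%:R - i%:R) * g (inord i.+1 : 'I_N.+1) = (N%:R - i%:R) * g i.+1.
  have := ltn_ord i; rewrite ltnS leq_eqVlt => /predU1P[->|iN].
    by rewrite subrr !mul0r.
  by rewrite inordK.
rewrite /sep_generator /= !pred_val; congr (_ + _).
  rewrite -!mulrA; congr (_ * _).
  exact: (succ_val x.2 (fun m => f x.1.-1 m - f x.1 x.2)).
rewrite -!mulrA ![_%:R * (f _ _ - _)]mulrC !mulrA; congr (_ * _).
exact: (succ_val x.1 (fun m => f m x.2.-1 - f x.1 x.2)).
Qed.

(** At each site, [a] and [b] stand for lowering and raising in the first variable, [c] and [d] for
    those in the second. *)
Lemma coproduct_form_invariant (R : realFieldType)
    (N p q x y n m k1 k2 a1 b1 a2 b2 c1 d1 c2 d2 : R) :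
  q ^+ 2 = p * (1 - p) ->
  (x - N / 2) * k1 = - q * (c1 + d1) + (1 - 2 * p) * ((n - N / 2) * k1) ->
  (y - N / 2) * k2 = - q * (c2 + d2) + (1 - 2 * p) * ((m - N / 2) * k2) ->
  a1 + b1 = - (1 - 2 * p) * (c1 + d1) - 4 * q * ((n - N / 2) * k1) ->
  a2 + b2 = - (1 - 2 * p) * (c2 + d2) - 4 * q * ((m - N / 2) * k2) ->
  a1 - b1 = c1 - d1 -> a2 - b2 = c2 - d2 ->
  a1 * b2 + b1 * a2 - (x * (N - y) + (N - x) * y) * (k1 * k2)
  = c1 * d2 + d1 * c2 - (n * (N - m) + (N - n) * m) * (k1 * k2).
Proof.
move=> q_sqr hx hy s1 s2 d1E d2E.
have coproduct z t e1 f1 e2 f2 :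
    e1 * f2 + f1 * e2 - (z * (N - t) + (N - z) * t) * (k1 * k2)
    = ((e1 + f1) * (e2 + f2) - (e1 - f1) * (e2 - f2)) / 2
      + 2 * (((z - N / 2) * k1) * ((t - N / 2) * k2))
      - N ^+ 2 / 2 * (k1 * k2) by field.
rewrite !coproduct s1 s2 d1E d2E hx hy.
move: (c1 + d1) (c2 + d2) (c1 - d1) (c2 - d2) ((n - _) * k1) ((m - _) * k2).
move=> S1 S2 D1 D2 h1 h2.
(* The mixed products of [S] and [h] cancel; the remaining discrepancy is a multiple of
   [4 q^2 + (1 - 2p)^2 - 1], which is 0. *)
transitivity ((S1 * S2 - D1 * D2) / 2 + 2 * (h1 * h2) - N ^+ 2 / 2 * (k1 * k2)
  + (4 * q ^+ 2 + (1 - 2 * p) ^+ 2 - 1) * (S1 * S2 / 2 + 2 * (h1 * h2))).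
  by field.
by rewrite q_sqr; field.
Qed.

Theorem theorem4p5 (R : realType) (twoj : nat) (htwoj : (0 < twoj)%N)
    (p : R) (hp0 : 0 < p) (hp1 : p < 1) :
  self_dual (@sep_generator R twoj) (@sep_duality R twoj p).
Proof.
move=> [x1 x2] [n1 n2]; pose k (x n : nat) := sep_site_duality twoj p x n.
rewrite (@sep_generatorE _ _ (fun a b => k a n1 * k b n2)).
rewrite (@sep_generatorE _ _ (fun a b => k x1 a * k x2 b)) /=.
have le_N (i : 'I_twoj.+1) : (i <= twoj)%N by rewrite -ltnS.
transitivity
  (lowerx R twoj p x1 n1 * raisex R twoj p x2 n2
   + raisex R twoj p x1 n1 * lowerx R twoj p x2 n2
   - (x1%:R * (twoj%:R - x2%:R) + (twoj%:R - x1%:R) * x2%:R)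
     * (k x1 n1 * k x2 n2)).
  by rewrite /lowerx /raisex /k /=; ring.
transitivity
  (lowern R twoj p x1 n1 * raisen R twoj p x2 n2
   + raisen R twoj p x1 n1 * lowern R twoj p x2 n2
   - (n1%:R * (twoj%:R - n2%:R) + (twoj%:R - n1%:R) * n2%:R)
     * (k x1 n1 * k x2 n2)); last first.
  by rewrite /lowern /raisen /k /=; ring.
apply: (coproduct_form_invariant _ _ p _ _ _ _ _ _ _ _ _ _ _ _ _ _ _
  (site_q_sqr R p hp0 hp1)).
- exact: site_weight.
- exact: site_weight.
- exact: site_shift_sum.
- exact: site_shift_sum.
- exact: site_shift_diff.
- exact: site_shift_diff.
Qed.
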